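(* Let $n\ge2$, let $T$ be a strict t-norm, let $p,q>0$, let $\alpha_i=\langle\mu_{\alpha_i},\eta_{\alpha_i},\nu_{\alpha_i}\rangle$ ($i=1,\dots,n$) be picture fuzzy numbers, and let $\omega=(\omega_1,\dots,\omega_n)^{\mathrm T}$ be their weight vector with $\omega_i\in(0,1]$ and $\sum_{i=1}^n\omega_i=1$. Then $$\big\langle\min_i\mu_{\alpha_i},\ \min_i\eta_{\alpha_i},\ \max_i\nu_{\alpha_i}\big\rangle\preccurlyeq_{\mathrm W}\mathrm{PFINWBM}_T^{p,q}(\alpha_1,\dots,\alpha_n)\preccurlyeq_{\mathrm W}\big\langle\max_i\mu_{\alpha_i},\ 1-(\max_i\mu_{\alpha_i}+\min_i\nu_{\alpha_i}),\ \min_i\nu_{\alpha_i}\big\rangle.$$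
   Context: A picture fuzzy number (PFN) is a triple $\alpha=\langle\mu,\eta,\nu\rangle$ with $\mu,\eta,\nu\in[0,1]$ and $\mu+\eta+\nu\le1$. Order on PFNs: for $\alpha=\langle\mu_\alpha,\eta_\alpha,\nu_\alpha\rangle$ put $S(\alpha)=\mu_\alpha-\nu_\alpha$, $H_1(\alpha)=\mu_\alpha+\nu_\alpha$, $H_2(\alpha)=\mu_\alpha+\eta_\alpha+\nu_\alpha$. Then $\alpha\prec_{\mathrm W}\beta$ iff $(S(\alpha),H_1(\alpha),H_2(\alpha))$ is strictly lexicographically smaller than $(S(\beta),H_1(\beta),H_2(\beta))$, and $\alpha\preccurlyeq_{\mathrm W}\beta$ means $\alpha\prec_{\mathrm W}\beta$ or $\alpha=\beta$ (a linear order). A t-norm is a commutative, associative map $T:[0,1]^2\to[0,1]$, nondecreasing in each variable, with $T(1,x)=x$. It is strict if it is continuous and $T(x,y)<T(x,z)$ whenever $x>0$ and $y<z$. A strict t-norm has a continuous additive generator: a continuous strictly decreasing bijection $\tau:[0,1]\to[0,+\infty]$ with $\tau(1)=0$, $\tau(0)=+\infty$ and $T(x,y)=\tau^{-1}(\tau(x)+\tau(y))$. Its dual t-conorm is $S(x,y)=1-T(1-x,1-y)=\zeta^{-1}(\zeta(x)+\zeta(y))$, where $\zeta(x)=\tau(1-x)$. Arithmetic in $[0,+\infty]$ is the usual one ($a+\infty=\infty$, $\lambda\cdot\infty=\infty$ for $\lambda>0$). For a strict t-norm $T$, PFNs $\alpha_k=\langle\mu_k,\eta_k,\nu_k\rangle$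 ($k=1,2$), $\alpha=\langle\mu,\eta,\nu\rangle$ and $\lambda>0$ define: $\alpha_1\oplus\alpha_2=\langle S(\mu_1,\mu_2),\,T(\eta_1+\nu_1,\eta_2+\nu_2)-T(\nu_1,\nu_2),\,T(\nu_1,\nu_2)\rangle$; $\alpha_1\otimes\alpha_2=\langle T(\mu_1,\mu_2),\,T(\eta_1+\mu_1,\eta_2+\mu_2)-T(\mu_1,\mu_2),\,S(\nu_1,\nu_2)\rangle$; $\lambda\cdot\alpha=\langle\zeta^{-1}(\lambda\zeta(\mu)),\,\tau^{-1}(\lambda\tau(\eta+\nu))-\tau^{-1}(\lambda\tau(\nu)),\,\tau^{-1}(\lambda\tau(\nu))\rangle$; $\alpha^\lambda=\langle\tau^{-1}(\lambda\tau(\mu)),\,\tau^{-1}(\lambda\tau(\eta+\mu))-\tau^{-1}(\lambda\tau(\mu)),\,\zeta^{-1}(\lambda\zeta(\nu))\rangle$. These operations send PFNs to PFNs, and $\oplus,\otimes$ are commutative and associative (known facts), so iterated $\bigoplus$ is well defined. For $p,q>0$ the picture fuzzy interactional normalized weighted Bonferroni mean induced by $T$ (with weight vector $\omega$) is $$\mathrm{PFINWBM}_T^{p,q}(\alpha_1,\dots,\alpha_n)=\Big[\bigoplus_{i,j=1,\ i\ne j}^n\tfrac{\omega_i\omega_j}{1-\omega_i}\cdot(\alpha_i^p\otimes\alpha_j^q)\Big]^{\frac1{p+q}}.$$ The order $\preccurlyeq_{\mathrm W}$ is applied, via the same functions $S,H_1,H_2$, to the triples bounding the mean in the claim. *)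

(* Defs.v *)
From HB Require Import structures.
From mathcomp Require Import all_boot all_order all_algebra.
From mathcomp Require Import all_classical all_reals topology normedtype ereal.
Set Implicit Arguments.
Unset Strict Implicit.
Unset Printing Implicit Defensive.
Import Order.TTheory GRing.Theory Num.Theory.
Import numFieldNormedType.Exports.
Local Open Scope classical_set_scope.
Local Open Scope ring_scope.

Section TNorms.
Variable R : realType.

(* Maps on [0,1] are total functions on R, constrained only on [0,1]. *)
Record is_tnorm (T : R -> R -> R) : Prop := IsTNorm {
  tnorm_closed : forall x y, 0 <= x <= 1 -> 0 <= y <= 1 -> 0 <= T x y <= 1;
  tnormC : forall x y, 0 <= x <= 1 -> 0 <= y <= 1 -> T x y = T y x;
  tnormA : forall x y z, 0 <= x <= 1 -> 0 <= y <= 1 -> 0 <= z <= 1 ->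
    T x (T y z) = T (T x y) z;
  tnorm_homo : forall x x' y y', 0 <= x -> x <= x' -> x' <= 1 ->
    0 <= y -> y <= y' -> y' <= 1 -> T x y <= T x' y';
  tnorm1x : forall x, 0 <= x <= 1 -> T 1 x = x }.

Record is_strict_tnorm (T : R -> R -> R) : Prop := IsStrictTNorm {
  strict_tnorm_tnorm : is_tnorm T;
  strict_tnorm_continuous :
    {within `[0, 1] `*` `[0, 1], continuous (fun z : R * R => T z.1 z.2)};
  strict_tnorm_lt : forall x y z, 0 < x <= 1 -> 0 <= y -> y < z -> z <= 1 ->
    T x y < T x z }.

Definition tconorm (T : R -> R -> R) (x y : R) : R := 1 - T (1 - x) (1 - y).

Definition unit_inv (f : R -> \bar R) : \bar R -> R :=
  'pinv_(fun=> 0) [set` `[(0 : R), 1]] f.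

Record is_additive_generator (T : R -> R -> R) (tau : R -> \bar R) : Prop :=
  IsAdditiveGenerator {
  generator_continuous : {within `[0, 1], continuous tau};
  generator_decreasing : forall x y, 0 <= x -> x < y -> y <= 1 ->
    (tau y < tau x)%E;
  generator_bij : set_bij [set` `[(0 : R), 1]] [set y | (0 <= y)%E] tau;
  generator1 : tau 1 = 0%E;
  generator0 : tau 0 = +oo%E;
  generatorE : forall x y, 0 <= x <= 1 -> 0 <= y <= 1 ->
    T x y = unit_inv tau (tau x + tau y)%E }.

Definition conj_generator (tau : R -> \bar R) (x : R) : \bar R := tau (1 - x).

End TNorms.

Section PictureFuzzy.
Variable R : realType.

(* Arbitrary real triples; the picture fuzzy numbers are those satisfying
   is_pfn below. *)
Record triple := Triple { mu : R; eta : R; nu : R }.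

Definition is_pfn (a : triple) : Prop :=
  [/\ 0 <= mu a <= 1, 0 <= eta a <= 1, 0 <= nu a <= 1
    & mu a + eta a + nu a <= 1].

Definition score (a : triple) : R := mu a - nu a.
Definition accuracy1 (a : triple) : R := mu a + nu a.
Definition accuracy2 (a : triple) : R := mu a + eta a + nu a.

Definition ltW (a b : triple) : Prop :=
  [\/ score a < score b,
      score a = score b /\ accuracy1 a < accuracy1 b
    | [/\ score a = score b, accuracy1 a = accuracy1 b
        & accuracy2 a < accuracy2 b]].

Definition leW (a b : triple) : Prop := ltW a b \/ a = b.

Definition pf_add (T : R -> R -> R) (a b : triple) : triple :=
  Triple (tconorm T (mu a) (mu b))
         (T (eta a + nu a) (eta b + nu b) - T (nu a) (nu b))
         (T (nu a) (nu b)).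

Definition pf_mul (T : R -> R -> R) (a b : triple) : triple :=
  Triple (T (mu a) (mu b))
         (T (eta a + mu a) (eta b + mu b) - T (mu a) (mu b))
         (tconorm T (nu a) (nu b)).

Definition pf_scale (tau : R -> \bar R) (l : R) (a : triple) : triple :=
  let zeta := conj_generator tau in
  Triple (unit_inv zeta (l%:E * zeta (mu a))%E)
         (unit_inv tau (l%:E * tau (eta a + nu a)%R)%E
            - unit_inv tau (l%:E * tau (nu a))%E)
         (unit_inv tau (l%:E * tau (nu a))%E).

Definition pf_pow (tau : R -> \bar R) (a : triple) (l : R) : triple :=
  let zeta := conj_generator tau in
  Triple (unit_inv tau (l%:E * tau (mu a))%E)
         (unit_inv tau (l%:E * tau (eta a + mu a)%R)%E
            - unit_inv tau (l%:E * tau (mu a))%E)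
         (unit_inv zeta (l%:E * zeta (nu a))%E).

(* The neutral element of pf_add on picture fuzzy numbers; it only serves as
   the starting value of the iterated sum. *)
Definition pf_zero : triple := Triple 0 0 1.

Lemma pf_addr0 (T : R -> R -> R) (a : triple) :
  is_tnorm T -> is_pfn a -> pf_add T a pf_zero = a.
Proof.
case: a => m e v hT [/= /andP[m0 m1] /andP[e0 e1] /andP[v0 v1] h].
have Tx1 x : 0 <= x <= 1 -> T x 1 = x.
  by move=> hx; rewrite (tnormC hT) ?ler01 ?lexx// (tnorm1x hT).
have ev : 0 <= e + v <= 1.
  by rewrite addr_ge0//= (le_trans _ h)// -addrA lerDr.
rewrite /pf_add /tconorm /= subr0 add0r !Tx1 ?v0//.
  by rewrite opprB addrCA subrr addr0 addrK.
by rewrite subr_ge0 m1 /= lerBlDr lerDl.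
Qed.

Definition pfinwbm (n : nat) (T : R -> R -> R) (tau : R -> \bar R) (p q : R)
    (omega : 'I_n -> R) (alpha : 'I_n -> triple) : triple :=
  pf_pow tau
    (\big[pf_add T/pf_zero]_(ij : 'I_n * 'I_n | ij.1 != ij.2)
       pf_scale tau (omega ij.1 * omega ij.2 / (1 - omega ij.1))
         (pf_mul T (pf_pow tau (alpha ij.1) p) (pf_pow tau (alpha ij.2) q)))
    (p + q)^-1.

(* For n > 0 and values in [0,1], the starting values 1 and 0 are absorbed, so
   these are the actual minimum and maximum. *)
Definition unit_min (n : nat) (f : 'I_n -> R) : R :=
  \big[Num.min/1]_(i < n) f i.
Definition unit_max (n : nat) (f : 'I_n -> R) : R :=
  \big[Num.max/0]_(i < n) f i.

End PictureFuzzy.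

Arguments pf_zero {R}.

(* Main.v *)
(** Read through the generator, [mu] and [1 - nu] of the mean are one and the
    same function [bonf] of the families [mu alpha_i] and [1 - nu alpha_i].
    This function stays between the minimum and the maximum of its arguments,
    so the score is compared strictly unless [mu] and [nu] of the mean both
    equal their bounds.
    - Lower bound: since all weights are positive, [bonf] can equal the minimum
      only if every pair [(i, j)] contributes the minimal value.  (For minimum 0
      one argument may still be nonzero, so the [alpha_i] themselves need not
      agree.)  With [mu] and [nu] of all the pairs constant, the [eta] of the
      mean is monotone in the sums [eta alpha_i + mu alpha_i], hence at least
      [min eta].
    - Upper bound: the right-hand triple has [mu + eta + nu = 1], and the mean
      is a picture fuzzy number. *)
Require Import Defs.
From mathcomp Require Import all_boot all_order all_algebra.
From mathcomp Require Import all_classical all_reals.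
From mathcomp Require Import lra.
Import Order.TTheory GRing.Theory Num.Theory.
Local Open Scope ring_scope.
Set Implicit Arguments.
Unset Strict Implicit.

Lemma onemI (R : realType) (x : R) : 0 <= x <= 1 -> 0 <= 1 - x <= 1.
Proof. lra. Qed.

(** * Weighted averages of extended reals *)

Section WeightedAverage.
Context (R : realType) (I : finType) (P : pred I) (w : I -> R).
Hypothesis w_gt0 : forall k, P k -> 0 < w k.
Hypothesis w_sum : \sum_(k | P k) w k = 1.
Implicit Types (f : I -> \bar R) (c : \bar R).

(** Distributivity over nonnegative weights is valid for every extended real [c], infinite values
    included. *)
Lemma wavg_const c : (\sum_(k | P k) (w k)%:E * c = c)%E.
Proof.
rewrite -ge0_sume_distrl ?sumEFin ?w_sum ?mul1e// => k /w_gt0.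
by rewrite lee_fin => /ltW.
Qed.

Lemma wavg_le f c : (forall k, P k -> (f k <= c)%E) ->
  (\sum_(k | P k) (w k)%:E * f k <= c)%E.
Proof.
move=> fc; rewrite -[leRHS]wavg_const; apply: lee_sum => k Pk.
by apply: lee_wpmul2l; [rewrite lee_fin ltW ?w_gt0|exact: fc].
Qed.

Lemma wavg_ge f c : (forall k, P k -> (c <= f k)%E) ->
  (c <= \sum_(k | P k) (w k)%:E * f k)%E.
Proof.
move=> fc; rewrite -[leLHS]wavg_const; apply: lee_sum => k Pk.
by apply: lee_wpmul2l; [rewrite lee_fin ltW ?w_gt0|exact: fc].
Qed.

(** A value above [c] has positive weight, so it would push the average strictly above [c].
    Finiteness of [c] keeps the inequality strict when the other terms are added. *)
Lemma wavg_min_eq f c : c \is a fin_num -> (forall k, P k -> (c <= f k)%E) ->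
  (\sum_(k | P k) (w k)%:E * f k = c)%E -> forall k, P k -> f k = c.
Proof.
move=> cfin fc fE k Pk; apply/eqP; rewrite eq_le fc// andbT leNgt.
apply/negP => cf.
have wk : (0 < (w k)%:E)%E by rewrite lte_fin w_gt0.
suff : (\sum_(j | P j) (w j)%:E * c < \sum_(j | P j) (w j)%:E * f j)%E.
  by rewrite fE wavg_const ltxx.
rewrite (bigD1 k)//= [ltRHS](bigD1 k)//=; apply: lte_leD.
- by apply/sum_fin_numP => j _ _; rewrite fin_numM.
- by rewrite lte_pmul2l.
- apply: lee_sum => j /andP[Pj _].
  by apply: lee_wpmul2l; [rewrite lee_fin ltW ?w_gt0|exact: fc].
Qed.

End WeightedAverage.

(** * Additive generators, their inverses, and the means they induce *)

Section Generator.
Context (R : realType) (T : R -> R -> R) (tau : R -> \bar R).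
Hypothesis htau : is_additive_generator T tau.

Local Notation g := (unit_inv tau).
Implicit Types (x y l : R) (u v : \bar R).

Lemma generator_ge0 x : 0 <= x <= 1 -> (0 <= tau x)%E.
Proof.
move=> x01; have [+ _ _] := generator_bij htau.
by move=> /(_ x); apply; rewrite /= in_itv.
Qed.

Lemma generator_inj x y : 0 <= x <= 1 -> 0 <= y <= 1 -> tau x = tau y -> x = y.
Proof.
move=> x01 y01; have [_ + _] := generator_bij htau.
by apply; rewrite inE /= in_itv.
Qed.

Lemma generator_invK x : 0 <= x <= 1 -> g (tau x) = x.
Proof.
move=> x01; have [_ inj _] := generator_bij htau.
by apply: (@pinvKV _ _ (fun=> 0) _ _ inj); rewrite inE /= in_itv.
Qed.

Lemma generatorK u : (0 <= u)%E -> tau (g u) = u.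
Proof.
move=> u0; have [_ _ surj] := generator_bij htau.
by apply: (@surjpK _ _ (fun=> 0) _ _ _ surj); rewrite inE.
Qed.

Lemma generator_inv01 u : (0 <= u)%E -> 0 <= g u <= 1.
Proof.
move=> u0; have [+ _ _] := bijpinv_bij (fun=> 0) (generator_bij htau).
by move=> /(_ u u0) /=; rewrite in_itv.
Qed.

Lemma generator_le x y : 0 <= x -> x <= y -> y <= 1 -> (tau y <= tau x)%E.
Proof.
move=> x0; rewrite le_eqVlt => /predU1P[-> //|xy] y1.
by apply/ltW/(generator_decreasing htau).
Qed.

Lemma generator_le_inv x y : 0 <= x <= 1 -> 0 <= y <= 1 ->
  (tau y <= tau x)%E -> x <= y.
Proof.
move=> /andP[_ x1] /andP[y0 _] txy; rewrite leNgt; apply/negP => yx.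
by have := generator_decreasing htau y0 yx x1; rewrite ltNge txy.
Qed.

Lemma generator_inv_le u v : (0 <= u)%E -> (u <= v)%E -> g v <= g u.
Proof.
move=> u0 uv; have v0 := le_trans u0 uv.
by apply: generator_le_inv; rewrite ?generator_inv01// !generatorK.
Qed.

Lemma generator_fin x : 0 < x <= 1 -> tau x \is a fin_num.
Proof.
move=> /andP[x0 x1]; rewrite ge0_fin_numE ?generator_ge0 ?(ltW x0)//.
by rewrite -(generator0 htau) (generator_decreasing htau).
Qed.

(** Since [u] is the value of the conjugate generator at [1 - g u], injectivity on the unit interval
    suffices. This turns every [zeta] in the operations into a complement. *)
Lemma conj_generator_inv u : (0 <= u)%E ->
  unit_inv (conj_generator tau) u = 1 - g u.
Proof.
move=> u0; have gu := generator_inv01 u0.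
have {1}-> : u = conj_generator tau (1 - g u).
  by rewrite /conj_generator subKr generatorK.
apply: (@pinvKV _ _ (fun=> 0)); last by rewrite inE /= in_itv /= onemI.
move=> a b; rewrite !inE /= !in_itv /= /conj_generator => a01 b01.
by move=> /generator_inj -/(_ (onemI a01) (onemI b01)); lra.
Qed.

(** The power of [x] with respect to [T]: for a positive integer [l] and [x] in [0,1], the [l]-fold
    [T]-product of [x]. *)
Definition tpow (l x : R) : R := g (l%:E * tau x)%E.

Section Tpow.
Context (l : R).
Hypothesis l_gt0 : 0 < l.

Lemma tpow_arg_ge0 x : 0 <= x <= 1 -> (0 <= l%:E * tau x)%E.
Proof. by move=> ?; rewrite mule_ge0 ?lee_fin ?generator_ge0// ltW. Qed.

Lemma tpow01 x : 0 <= x <= 1 -> 0 <= tpow l x <= 1.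
Proof. by move=> ?; rewrite generator_inv01// tpow_arg_ge0. Qed.

Lemma generator_tpow x : 0 <= x <= 1 -> tau (tpow l x) = (l%:E * tau x)%E.
Proof. by move=> ?; rewrite generatorK ?tpow_arg_ge0. Qed.

Lemma tpow_le x y : 0 <= x -> x <= y -> y <= 1 -> tpow l x <= tpow l y.
Proof.
move=> x0 xy y1; apply: generator_inv_le.
  by rewrite tpow_arg_ge0// y1 (le_trans x0).
by apply: lee_wpmul2l; [rewrite lee_fin ltW|exact: generator_le].
Qed.

Lemma tpowVK x : 0 <= x <= 1 -> tpow l^-1 (tpow l x) = x.
Proof.
move=> x01; rewrite /tpow -/(tpow l x) generator_tpow// muleA -EFinM.
by rewrite mulVf ?gt_eqF// mul1e generator_invK.
Qed.

Lemma tpowKV x : 0 <= x <= 1 -> tpow l (tpow l^-1 x) = x.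
Proof.
move=> x01; rewrite /tpow generatorK.
  by rewrite muleA -EFinM mulfV ?gt_eqF// mul1e generator_invK.
by rewrite mule_ge0 ?generator_ge0// lee_fin invr_ge0 ltW.
Qed.

End Tpow.

(** The weighted quasi-arithmetic mean generated by [tau]. *)
Definition tmean (I : finType) (P : pred I) (w : I -> R) (h : I -> R) : R :=
  g (\sum_(k | P k) (w k)%:E * tau (h k))%E.

Section Tmean.
Context (I : finType) (P : pred I) (w : I -> R).
Hypothesis w_gt0 : forall k, P k -> 0 < w k.
Hypothesis w_sum : \sum_(k | P k) w k = 1.
Implicit Types (h : I -> R) (c : R).

Lemma tmean_arg_ge0 h : (forall k, P k -> 0 <= h k <= 1) ->
  (0 <= \sum_(k | P k) (w k)%:E * tau (h k))%E.
Proof.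
move=> h01; apply: sume_ge0 => k Pk.
by rewrite mule_ge0 ?lee_fin ?generator_ge0 ?h01// ltW ?w_gt0.
Qed.

Lemma tmean01 h : (forall k, P k -> 0 <= h k <= 1) -> 0 <= tmean P w h <= 1.
Proof. by move=> h01; rewrite generator_inv01// tmean_arg_ge0. Qed.

Lemma tmean_ge h c : 0 <= c -> (forall k, P k -> c <= h k <= 1) ->
  c <= tmean P w h.
Proof.
move=> c0 cy.
have h01 k : P k -> 0 <= h k <= 1 by move=> /cy; lra.
(* A bound above 1 is impossible: the weights sum to 1, so some index satisfies [P]. *)
have [c1|c1] := leP c 1; last first.
  have [k Pk|P0] := pickP P; first by have := cy _ Pk; lra.
  by move: w_sum; rewrite big_pred0//; lra.
apply: generator_le_inv; rewrite ?c0 ?tmean01//.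
rewrite generatorK ?tmean_arg_ge0//; apply: wavg_le => // k Pk.
by have /andP[? ?] := cy _ Pk; rewrite generator_le.
Qed.

Lemma tmean_le h c : c <= 1 -> (forall k, P k -> 0 <= h k <= c) ->
  tmean P w h <= c.
Proof.
move=> c1 yc.
have h01 k : P k -> 0 <= h k <= 1 by move=> /yc; lra.
have [c0|c0] := leP 0 c; last first.
  have [k Pk|P0] := pickP P; first by have := yc _ Pk; lra.
  by move: w_sum; rewrite big_pred0//; lra.
apply: generator_le_inv; rewrite ?c0 ?tmean01//.
rewrite generatorK ?tmean_arg_ge0//; apply: wavg_ge => // k Pk.
by have /andP[? ?] := yc _ Pk; rewrite generator_le.
Qed.

(** As [tau] is decreasing, a maximum of [h] is a minimum of the generator values, and [wavg_min_eq]
    applies. The analogue for the minimum fails at 0, where a single zero argument makes the whole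
    mean 0. *)
Lemma tmean_max_eq h c : c <= 1 -> (forall k, P k -> 0 <= h k <= c) ->
  tmean P w h = c -> forall k, P k -> h k = c.
Proof.
move=> c1 yc yE k Pk; have h01 j : P j -> 0 <= h j <= 1 by move=> /yc; lra.
have /andP[yk0 ykc] := yc _ Pk.
(* [tau 0] is infinite, so this case is settled by the bounds on [h k] alone. *)
have [c0|c0] := leP c 0; first by lra.
have c01 : 0 < c <= 1 by rewrite c0.
apply: generator_inj; [exact: h01|lra|].
apply: (wavg_min_eq w_gt0 w_sum (f := fun k => tau (h k))) => //.
- exact: generator_fin.
- by move=> j /yc /andP[? ?]; rewrite generator_le.
- by rewrite -[in RHS]yE generatorK ?tmean_arg_ge0.
Qed.

End Tmean.

(** On [0,1] this is [T (tpow p x) (tpow q y)], in a form whose monotonicity is read off the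
    generator. *)
Definition tpair (p q x y : R) : R := g (p%:E * tau x + q%:E * tau y)%E.

Section Tpair.
Context (p q : R).
Hypotheses (p_gt0 : 0 < p) (q_gt0 : 0 < q).

Lemma tpair_arg_ge0 x y : 0 <= x <= 1 -> 0 <= y <= 1 ->
  (0 <= p%:E * tau x + q%:E * tau y)%E.
Proof. by move=> x01 y01; rewrite adde_ge0 ?tpow_arg_ge0. Qed.

Lemma tpair01 x y : 0 <= x <= 1 -> 0 <= y <= 1 -> 0 <= tpair p q x y <= 1.
Proof. by move=> x01 y01; rewrite generator_inv01 ?tpair_arg_ge0. Qed.

Lemma tpair_le x x' y y' : 0 <= x -> x <= x' -> x' <= 1 ->
  0 <= y -> y <= y' -> y' <= 1 -> tpair p q x y <= tpair p q x' y'.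
Proof.
move=> x0 xx' x'1 y0 yy' y'1; apply: generator_inv_le.
  by apply: tpair_arg_ge0; lra.
by apply: leeD; apply: lee_wpmul2l; rewrite ?lee_fin; do ?exact: ltW;
  exact: generator_le.
Qed.

(** The total exponent [p + q] is the one that the outer power [(p + q)^-1] of the mean undoes, so
    constant bounds come back unchanged. *)
Lemma tpair_diag x : tpair p q x x = tpow (p + q) x.
Proof. by rewrite /tpair /tpow EFinD ge0_muleDl ?lee_fin ?ltW. Qed.

Lemma tpair_tpow x y : 0 <= x <= 1 -> 0 <= y <= 1 ->
  T (tpow p x) (tpow q y) = tpair p q x y.
Proof.
move=> x01 y01.
by rewrite (generatorE htau) ?tpow01// !generator_tpow.
Qed.

End Tpair.

Lemma generator_tnorm x y : 0 <= x <= 1 -> 0 <= y <= 1 ->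
  tau (T x y) = (tau x + tau y)%E.
Proof.
move=> x01 y01; rewrite (generatorE htau)// generatorK//.
by rewrite adde_ge0 ?generator_ge0.
Qed.

(** * The scalar Bonferroni mean: bounds and the case of equality *)

Section Bonferroni.
Context (I : finType) (P : pred (I * I)) (w : I * I -> R) (p q : R).
Hypotheses (p_gt0 : 0 < p) (q_gt0 : 0 < q).
Hypothesis w_gt0 : forall k, P k -> 0 < w k.
Hypothesis w_sum : \sum_(k | P k) w k = 1.
Implicit Types (f : I -> R) (c : R).

(** The pairs are averaged with the generator of the dual t-conorm, hence the two complements. *)
Definition bonf f : R :=
  tpow (p + q)^-1 (1 - tmean P w (fun k => 1 - tpair p q (f k.1) (f k.2))).

Let pq_gt0 : 0 < p + q. Proof. exact: addr_gt0. Qed.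
Let pqV_gt0 : 0 < (p + q)^-1. Proof. by rewrite invr_gt0. Qed.

Lemma bonf_arg01 f : (forall i, 0 <= f i <= 1) ->
  0 <= 1 - tmean P w (fun k => 1 - tpair p q (f k.1) (f k.2)) <= 1.
Proof. by move=> f01; apply/onemI/tmean01 => // k _; apply/onemI/tpair01. Qed.

Lemma tpair_ge_tpow f c : 0 <= c -> (forall i, c <= f i <= 1) ->
  forall k, tpow (p + q) c <= tpair p q (f k.1) (f k.2) <= 1.
Proof.
move=> c0 cf k; have /andP[? ?] := cf k.1; have /andP[? ?] := cf k.2.
have := @tpair_le _ _ p_gt0 q_gt0 c (f k.1) c (f k.2).
have := @tpair01 _ _ p_gt0 q_gt0 (f k.1) (f k.2).
by rewrite tpair_diag//; lra.
Qed.

Lemma tpair_le_tpow f c : c <= 1 -> (forall i, 0 <= f i <= c) ->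
  forall k, 0 <= tpair p q (f k.1) (f k.2) <= tpow (p + q) c.
Proof.
move=> c0 cf k; have /andP[? ?] := cf k.1; have /andP[? ?] := cf k.2.
have := @tpair_le _ _ p_gt0 q_gt0 (f k.1) c (f k.2) c.
have := @tpair01 _ _ p_gt0 q_gt0 (f k.1) (f k.2).
by rewrite tpair_diag//; lra.
Qed.

Lemma bonf_ge f c : 0 <= c <= 1 -> (forall i, c <= f i <= 1) -> c <= bonf f.
Proof.
move=> c01 cf; have f01 i : 0 <= f i <= 1 by have := cf i; lra.
(* With [c] written as the root of [tpow (p + q) c], monotonicity of the root leaves only the
   average of the pairs to compare. *)
rewrite -[leLHS](tpowVK pq_gt0 c01).
have := bonf_arg01 f01; have := tpow01 pq_gt0 c01 => pc01 arg01.
apply: tpow_le => //; [lra| |lra].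
rewrite lerBrDr addrC -lerBrDr; apply: tmean_le => //; first by lra.
by move=> k _; have := @tpair_ge_tpow f c _ cf k; lra.
Qed.

Lemma bonf_le f c : 0 <= c <= 1 -> (forall i, 0 <= f i <= c) -> bonf f <= c.
Proof.
move=> c01 cf; have f01 i : 0 <= f i <= 1 by have := cf i; lra.
rewrite -[leRHS](tpowVK pq_gt0 c01).
have := bonf_arg01 f01; have := tpow01 pq_gt0 c01 => pc01 arg01.
apply: tpow_le => //; [lra| |lra].
rewrite lerBlDr addrC -lerBlDr; apply: tmean_ge => //; first by lra.
by move=> k _; have := @tpair_le_tpow f c _ cf k; lra.
Qed.

(** The pairs enter [tmean] through complements, so a minimum here is a maximum there, and
    [tmean_max_eq] covers [c = 0] as well. *)
Lemma bonf_min_eq f c : 0 <= c <= 1 -> (forall i, c <= f i <= 1) ->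
  bonf f = c -> forall k, P k -> tpair p q (f k.1) (f k.2) = tpow (p + q) c.
Proof.
move=> c01 cf fE k Pk; have f01 i : 0 <= f i <= 1 by have := cf i; lra.
have pc01 := tpow01 pq_gt0 c01.
have mE : tmean P w (fun k => 1 - tpair p q (f k.1) (f k.2)) =
    1 - tpow (p + q) c.
  by rewrite -fE /bonf tpowKV ?bonf_arg01// subKr.
have /= := @tmean_max_eq _ _ _ w_gt0 w_sum
  (fun k => 1 - tpair p q (f k.1) (f k.2)) (1 - tpow (p + q) c) _ _ mE k Pk.
move=> kE; suff : 1 - tpair p q (f k.1) (f k.2) = 1 - tpow (p + q) c by lra.
apply: kE; first by lra.
by move=> j _; have := @tpair_ge_tpow f c _ cf j; lra.
Qed.

End Bonferroni.

(** * Picture fuzzy operations expressed through the generator *)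

(* Exchanging [mu] and [nu] turns the multiplicative operations into the
   additive ones. *)
Definition pf_swap (a : triple R) : triple R := Triple (nu a) (eta a) (mu a).

Lemma pf_swap_pfn a : is_pfn a -> is_pfn (pf_swap a).
Proof. by case=> *; split => //=; lra. Qed.

Lemma pf_pow_swap a l :
  pf_pow tau a l = pf_swap (pf_scale tau l (pf_swap a)).
Proof. by []. Qed.

Lemma pf_mul_swap a b :
  pf_mul T a b = pf_swap (pf_add T (pf_swap a) (pf_swap b)).
Proof. by []. Qed.

Lemma pfn_unit (a : triple R) : is_pfn a ->
  [/\ 0 <= 1 - mu a <= 1, 0 <= eta a + nu a <= 1, 0 <= nu a <= 1
    & 0 <= eta a + mu a <= 1].
Proof. by case=> *; split; lra. Qed.

Lemma pf_scaleE l a : 0 < l -> is_pfn a -> pf_scale tau l a =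
  Triple (1 - tpow l (1 - mu a)) (tpow l (eta a + nu a) - tpow l (nu a))
         (tpow l (nu a)).
Proof.
move=> l0 /pfn_unit[m01 _ _ _].
by rewrite /pf_scale /= conj_generator_inv ?tpow_arg_ge0.
Qed.

(** Monotonicity of [tpow l] is applied twice: [nu a <= eta a + nu a] gives a nonnegative [eta], and
    [eta a + nu a <= 1 - mu a] gives a total of at most 1. *)
Lemma pf_scale_pfn l a : 0 < l -> is_pfn a -> is_pfn (pf_scale tau l a).
Proof.
move=> l0 a_pfn; have [m01 en01 n01 _] := pfn_unit a_pfn.
rewrite pf_scaleE//; case: a_pfn => ? ? ? ?.
have := tpow01 l0 m01; have := tpow01 l0 en01; have := tpow01 l0 n01.
have := @tpow_le l l0 (nu a) (eta a + nu a).
have := @tpow_le l l0 (eta a + nu a) (1 - mu a).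
by move=> h1 h2 *; split => /=; move: h1 h2; lra.
Qed.

Lemma pf_pow_pfn l a : 0 < l -> is_pfn a -> is_pfn (pf_pow tau a l).
Proof.
move=> l0 a_pfn; rewrite pf_pow_swap; apply/pf_swap_pfn/pf_scale_pfn => //.
exact: pf_swap_pfn.
Qed.

Section PfAdd.
Hypothesis hT : is_tnorm T.

Lemma pf_add_pfn a b : is_pfn a -> is_pfn b -> is_pfn (pf_add T a b).
Proof.
move=> a_pfn b_pfn.
have [am01 aen01 an01 _] := pfn_unit a_pfn.
have [bm01 ben01 bn01 _] := pfn_unit b_pfn.
case: a_pfn b_pfn => ? ? ? ? [? ? ? ?].
have := tnorm_closed hT am01 bm01; have := tnorm_closed hT an01 bn01.
have := tnorm_closed hT aen01 ben01.
have := @tnorm_homo _ _ hT (nu a) (eta a + nu a) (nu b) (eta b + nu b).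
have := @tnorm_homo _ _ hT (eta a + nu a) (1 - mu a) (eta b + nu b) (1 - mu b).
rewrite /pf_add /tconorm => h1 h2 *.
by split => /=; move: h1 h2; lra.
Qed.

Lemma pf_mul_pfn a b : is_pfn a -> is_pfn b -> is_pfn (pf_mul T a b).
Proof.
move=> ? ?; rewrite pf_mul_swap; apply/pf_swap_pfn/pf_add_pfn;
  exact: pf_swap_pfn.
Qed.

Section PfSum.
Context (I : finType) (P : pred I) (w : I -> R) (X : I -> triple R).
Hypothesis w_gt0 : forall k, P k -> 0 < w k.
Hypothesis X_pfn : forall k, is_pfn (X k).
Let s := \big[pf_add T/pf_zero]_(k | P k) pf_scale tau (w k) (X k).

(** Addition is not additive in [eta] itself but becomes so in [tau] of [1 - mu], [eta + nu] and
    [nu]. Membership in the picture fuzzy numbers is part of the induction because the generator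
    equations hold only on [0,1]. *)
Lemma pf_sum_generator : [/\ is_pfn s,
  tau (1 - mu s) = (\sum_(k | P k) (w k)%:E * tau (1 - mu (X k))%R)%E,
  tau (eta s + nu s) =
    (\sum_(k | P k) (w k)%:E * tau (eta (X k) + nu (X k))%R)%E
  & tau (nu s) = (\sum_(k | P k) (w k)%:E * tau (nu (X k)))%E].
Proof.
rewrite /s; elim: (index_enum I) => [|k r].
  (* For [pf_zero] all three tracked quantities equal 1, where [tau] vanishes. *)
  rewrite !big_nil /= subr0 add0r (generator1 htau).
  by split => //; split => /=; lra.
rewrite !big_cons; case: ifP => // /w_gt0 wk.
set t := \big[_/_]_(_ <- r | _) _ => -[t_pfn tm ten tn].
have c_pfn := pf_scale_pfn wk (X_pfn k).
have [m01 en01 n01 _] := pfn_unit (X_pfn k).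
have [cm01 cen01 cn01 _] := pfn_unit c_pfn.
have [tm01 ten01 tn01 _] := pfn_unit t_pfn.
have [cm cen cn] : [/\ tau (1 - mu (pf_scale tau (w k) (X k))) =
      ((w k)%:E * tau (1 - mu (X k))%R)%E,
    tau (eta (pf_scale tau (w k) (X k)) + nu (pf_scale tau (w k) (X k))) =
      ((w k)%:E * tau (eta (X k) + nu (X k))%R)%E
    & tau (nu (pf_scale tau (w k) (X k))) = ((w k)%:E * tau (nu (X k)))%E].
  by rewrite pf_scaleE//= subKr subrK !generator_tpow.
(* The scaled summand becomes a variable, known only through its generator equations and bounds, so
   that simplification cannot unfold it. *)
move: (pf_scale _ _ _) c_pfn cm01 cen01 cn01 cm cen cn.
move=> c c_pfn cm01 cen01 cn01 cm cen cn.
rewrite -cm -tm -cen -ten -cn -tn; split; first exact: pf_add_pfn.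
- by rewrite /= /tconorm subKr generator_tnorm.
- by rewrite /= subrK generator_tnorm.
- by rewrite /= generator_tnorm.
Qed.

Lemma pf_sum_pfn : is_pfn s.
Proof. by have [] := pf_sum_generator. Qed.

Lemma mu_pf_sum : mu s = 1 - tmean P w (fun k => 1 - mu (X k)).
Proof.
rewrite /tmean; have [/pfn_unit[m01 _ _ _] <- _ _] := pf_sum_generator.
by rewrite generator_invK// subKr.
Qed.

Lemma eta_nu_pf_sum :
  eta s + nu s = tmean P w (fun k => eta (X k) + nu (X k)).
Proof.
rewrite /tmean; have [/pfn_unit[_ en01 _ _] _ <- _] := pf_sum_generator.
by rewrite generator_invK.
Qed.

Lemma nu_pf_sum : nu s = tmean P w (fun k => nu (X k)).
Proof.
rewrite /tmean; have [/pfn_unit[_ _ n01 _] _ _ <-] := pf_sum_generator.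
by rewrite generator_invK.
Qed.

End PfSum.

Section PfPair.
Context (p q : R).
Hypotheses (p_gt0 : 0 < p) (q_gt0 : 0 < q).

Lemma pf_mul_powE a b : is_pfn a -> is_pfn b ->
  pf_mul T (pf_pow tau a p) (pf_pow tau b q) =
  Triple (tpair p q (mu a) (mu b))
         (tpair p q (eta a + mu a) (eta b + mu b) - tpair p q (mu a) (mu b))
         (1 - tpair p q (1 - nu a) (1 - nu b)).
Proof.
move=> a_pfn b_pfn.
have [am01 aen01 an01 aem01] := pfn_unit a_pfn.
have [bm01 ben01 bn01 bem01] := pfn_unit b_pfn.
case: (a_pfn) (b_pfn) => ? ? ? ? [? ? ? ?].
rewrite !pf_pow_swap !pf_scaleE; try exact: pf_swap_pfn; try by [].
rewrite /pf_mul /tconorm /= !subrK !subKr !tpair_tpow//; exact: onemI.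
Qed.

End PfPair.
End PfAdd.

(** * Componentwise bounds of the mean and the two comparisons *)

Section Mean.
Hypothesis hT : is_tnorm T.
Context (I : finType) (P : pred (I * I)) (w : I * I -> R) (p q : R).
Context (alpha : I -> triple R).
Hypotheses (p_gt0 : 0 < p) (q_gt0 : 0 < q).
Hypothesis w_gt0 : forall k, P k -> 0 < w k.
Hypothesis w_sum : \sum_(k | P k) w k = 1.
Hypothesis alpha_pfn : forall i, is_pfn (alpha i).

Let pq_gt0 : 0 < p + q. Proof. exact: addr_gt0. Qed.
Let pqV_gt0 : 0 < (p + q)^-1. Proof. by rewrite invr_gt0. Qed.

Let X k := pf_mul T (pf_pow tau (alpha k.1) p) (pf_pow tau (alpha k.2) q).
Let s := \big[pf_add T/pf_zero]_(k | P k) pf_scale tau (w k) (X k).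
Let res := pf_pow tau s (p + q)^-1.

Let X_pfn k : is_pfn (X k).
Proof. by apply: (pf_mul_pfn hT); apply: pf_pow_pfn. Qed.

Let s_pfn : is_pfn s. Proof. exact: pf_sum_pfn. Qed.

Lemma bonf_mean_pfn : is_pfn res. Proof. exact: pf_pow_pfn. Qed.

Let resE : res =
  Triple (tpow (p + q)^-1 (mu s))
         (tpow (p + q)^-1 (eta s + mu s) - tpow (p + q)^-1 (mu s))
         (1 - tpow (p + q)^-1 (1 - nu s)).
Proof.
by rewrite /res pf_pow_swap pf_scaleE//; apply: pf_swap_pfn.
Qed.

Lemma mu_bonf_mean : mu res = bonf P w p q (fun i => mu (alpha i)).
Proof.
rewrite resE /= /s mu_pf_sum// /bonf; congr (tpow _ (1 - tmean _ _ _)).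
by apply/funext => k; rewrite /X pf_mul_powE.
Qed.

Lemma nu_bonf_mean : nu res = 1 - bonf P w p q (fun i => 1 - nu (alpha i)).
Proof.
rewrite resE /= /s nu_pf_sum// /bonf.
congr (1 - tpow _ (1 - tmean _ _ _)).
by apply/funext => k; rewrite /X pf_mul_powE.
Qed.

(** Weights summing to 1 exclude an empty family. The index serves to place the bounds in [0,1]. *)
Let exists_index : exists i : I, true.
Proof.
have [k _|P0] := pickP P; first by exists k.1.
by move: w_sum; rewrite big_pred0// => /esym/eqP; rewrite oner_eq0.
Qed.

Lemma bonf_mean_mu_ge (m : R) : 0 <= m -> (forall i, m <= mu (alpha i)) ->
  m <= mu res.
Proof.
move=> m0 mP; have mi i : m <= mu (alpha i) <= 1.
  by have := mP i; case: (alpha_pfn i) => ? ? ? ?; lra.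
have [i0 _] := exists_index.
by rewrite mu_bonf_mean bonf_ge//; have := mi i0; lra.
Qed.

Lemma bonf_mean_mu_le (m : R) : m <= 1 -> (forall i, mu (alpha i) <= m) ->
  mu res <= m.
Proof.
move=> m1 mP; have mi i : 0 <= mu (alpha i) <= m.
  by have := mP i; case: (alpha_pfn i) => ? ? ? ?; lra.
have [i0 _] := exists_index.
by rewrite mu_bonf_mean bonf_le//; have := mi i0; lra.
Qed.

Lemma bonf_mean_nu_ge (v : R) : 0 <= v -> (forall i, v <= nu (alpha i)) ->
  v <= nu res.
Proof.
move=> v0 vP; have vi i : 0 <= 1 - nu (alpha i) <= 1 - v.
  by have := vP i; case: (alpha_pfn i) => ? ? ? ?; lra.
have [i0 _] := exists_index.
rewrite nu_bonf_mean lerBrDr addrC -lerBrDr bonf_le//.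
by have := vi i0; lra.
Qed.

Lemma bonf_mean_nu_le (v : R) : v <= 1 -> (forall i, nu (alpha i) <= v) ->
  nu res <= v.
Proof.
move=> v1 vP; have vi i : 1 - v <= 1 - nu (alpha i) <= 1.
  by have := vP i; case: (alpha_pfn i) => ? ? ? ?; lra.
have [i0 _] := exists_index.
rewrite nu_bonf_mean lerBlDr addrC -lerBlDr bonf_ge//.
by have := vi i0; lra.
Qed.

(** Powers and products control [eta + mu], whereas the sum controls [eta + nu]. Passing between the
    two requires [mu] and [nu] of every pair, and the equalities [mu res = m] and [nu res = v]
    determine them through [bonf_min_eq]. *)
Lemma bonf_mean_eta_ge (m e v : R) : 0 <= m -> 0 <= e -> v <= 1 ->
  (forall i, m <= mu (alpha i)) -> (forall i, e <= eta (alpha i)) ->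
  (forall i, nu (alpha i) <= v) -> mu res = m -> nu res = v -> e <= eta res.
Proof.
move=> m0 e0 v1 mP eP vP mE vE; have [i0 _] := exists_index.
have m01 : 0 <= m <= 1.
  by have := mP i0; case: (alpha_pfn i0) => ? ? ? ?; lra.
have v01 : 0 <= 1 - v <= 1.
  by have := vP i0; case: (alpha_pfn i0) => ? ? ? ?; lra.
have em01 : 0 <= e + m <= 1.
  by have := mP i0; have := eP i0; case: (alpha_pfn i0) => ? ? ? ?; lra.
have mi i : m <= mu (alpha i) <= 1.
  by have := mP i; case: (alpha_pfn i) => ? ? ? ?; lra.
have vi i : 1 - v <= 1 - nu (alpha i) <= 1.
  by have := vP i; case: (alpha_pfn i) => ? ? ? ?; lra.
have emi i : e + m <= eta (alpha i) + mu (alpha i) <= 1.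
  by have := mP i; have := eP i; case: (alpha_pfn i) => ? ? ? ?; lra.
have muX k : P k -> mu (X k) = tpow (p + q) m.
  move=> Pk; rewrite /X pf_mul_powE//=.
  apply: (bonf_min_eq p_gt0 q_gt0 w_gt0 w_sum
    (f := fun i => mu (alpha i))) => //.
  by rewrite -mu_bonf_mean.
have nuX k : P k -> nu (X k) = 1 - tpow (p + q) (1 - v).
  move=> Pk; rewrite /X pf_mul_powE//=; congr (1 - _).
  apply: (bonf_min_eq p_gt0 q_gt0 w_gt0 w_sum
    (f := fun i => 1 - nu (alpha i))) => //.
  by rewrite -vE nu_bonf_mean subKr.
have emX k : tpow (p + q) (e + m) <= eta (X k) + mu (X k).
  rewrite /X pf_mul_powE//= subrK.
  have [] // := andP (tpair_ge_tpow p_gt0 q_gt0 (proj1 (andP em01)) emi k).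
have [ms01 ens01 ns01 ems01] := pfn_unit s_pfn.
have mus : mu s = tpow (p + q) m.
  rewrite -mE resE /= tpowKV//; by case: s_pfn.
have nus : 1 - nu s = tpow (p + q) (1 - v).
  by rewrite -vE resE /= subKr tpowKV//; exact: onemI.
(* The bound [emX] on [eta + mu] becomes one on [eta + nu] by subtracting the common [mu] and adding
   the common [nu] of the pairs. Being a constant, it passes to the average. *)
have ens : tpow (p + q) (e + m) - tpow (p + q) m +
    (1 - tpow (p + q) (1 - v)) <= eta s + nu s.
  have -> : eta s + nu s = tmean P w (fun k => eta (X k) + nu (X k)).
    exact: eta_nu_pf_sum.
  apply: (tmean_ge w_gt0 w_sum).
    have := tpow01 pq_gt0 v01.
    have := @tpow_le _ pq_gt0 m (e + m); lra.
  move=> k Pk; have := emX k; have [_ + _ _] := pfn_unit (X_pfn k).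
  by rewrite muX// nuX//; lra.
(* By [mus] and [nus], [ens] says that [eta s + mu s] is at least [tpow (p + q) (e + m)], and the
   outer power recovers [e + m]. *)
suff : e + m <= eta res + mu res by lra.
rewrite [in leRHS]resE /= subrK -[leLHS](tpowVK pq_gt0 em01).
have := tpow01 pq_gt0 em01.
by move=> ?; apply: tpow_le => //; lra.
Qed.

Lemma bonf_mean_lower (m e v : R) : 0 <= m -> 0 <= e -> v <= 1 ->
  (forall i, m <= mu (alpha i)) -> (forall i, e <= eta (alpha i)) ->
  (forall i, nu (alpha i) <= v) -> leW (Triple m e v) res.
Proof.
move=> m0 e0 v1 mP eP vP.
have mr := bonf_mean_mu_ge m0 mP; have vr := bonf_mean_nu_le v1 vP.
have er := bonf_mean_eta_ge m0 e0 v1 mP eP vP.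
move: (res) mr vr er => [m' e' v'] /= mr vr er.
rewrite /leW /Defs.ltW /score /accuracy1 /accuracy2 /=.
have [ltS|geS] := ltP (m - v) (m' - v'); first by left; constructor.
(* Both components move the score in the same direction, so equal scores force equality in each. The
   key [accuracy1] therefore never decides. *)
have mE : m' = m by lra.
have vE : v' = v by lra.
rewrite mE vE; have := er mE vE; rewrite le_eqVlt => /predU1P[->|e_lt].
  by right.
by left; constructor 3; split; lra.
Qed.

Lemma bonf_mean_upper (m v : R) : 0 <= v -> m <= 1 ->
  (forall i, mu (alpha i) <= m) -> (forall i, v <= nu (alpha i)) ->
  leW res (Triple m (1 - (m + v)) v).
Proof.
move=> v0 m1 mP vP.
have mr := bonf_mean_mu_le m1 mP; have vr := bonf_mean_nu_ge v0 vP.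
have [_ _ _] := bonf_mean_pfn.
move: (res) mr vr => [m' e' v'] /= mr vr sum_le1.
rewrite /leW /Defs.ltW /score /accuracy1 /accuracy2 /=.
have [ltS|geS] := ltP (m' - v') (m - v); first by left; constructor.
have mE : m' = m by lra.
have vE : v' = v by lra.
move: sum_le1; rewrite mE vE le_eqVlt => /predU1P[sumE|sum_lt].
  by right; congr Triple; lra.
by left; constructor 3; split; lra.
Qed.

End Mean.
End Generator.

(** * Normalized weights, extrema and the conclusion *)

(** For fixed [i] the remaining weights sum to [1 - omega i], which cancels the denominator and
    leaves [omega i]. *)
Lemma bonf_weight_sum (R : realType) (n : nat) (omega : 'I_n -> R) :
  (forall i, omega i < 1) -> \sum_(i < n) omega i = 1 ->
  \sum_(ij : 'I_n * 'I_n | ij.1 != ij.2)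
    omega ij.1 * omega ij.2 / (1 - omega ij.1) = 1.
Proof.
move=> omega_lt1 omega_sum.
rewrite -(pair_big_dep xpredT (fun i j => i != j)
  (fun i j => omega i * omega j / (1 - omega i))) /=.
rewrite -[RHS]omega_sum; apply: eq_bigr => i _.
rewrite -mulr_suml -mulr_sumr.
have -> : \sum_(j | i != j) omega j = 1 - omega i.
  rewrite -omega_sum [X in X - _](bigD1 i)//= addrAC subrr add0r.
  by apply: eq_bigl => j; rewrite eq_sym.
by rewrite mulfK// subr_eq0 gt_eqF.
Qed.

Lemma weight_lt1 (R : realType) (n : nat) (omega : 'I_n -> R) : (2 <= n)%N ->
  (forall i, 0 < omega i) -> \sum_(i < n) omega i = 1 -> forall i, omega i < 1.
Proof.
move=> n2 omega_gt0 omega_sum i.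
have [j ji] : exists j : 'I_n, j != i.
  (* The witness is index 1 when [i] is 0, and index 0 otherwise; [n2] read as [1 < n] bounds the
     former. *)
  have [i0|i0] := eqVneq (val i) 0%N;
    [exists (Ordinal n2)|exists (Ordinal (ltnW n2))];
    by rewrite -val_eqE /= ?i0// eq_sym.
rewrite -omega_sum (bigD1 i)//= ltrDl (bigD1 j)//= ltr_pwDl//.
by apply: sumr_ge0 => k _; apply: ltW.
Qed.

Lemma unit_min_ge0 (R : realType) (n : nat) (f : 'I_n -> R) :
  (forall i, 0 <= f i) -> 0 <= unit_min f.
Proof. by move=> f_ge0; apply: le_bigmin => //; rewrite ler01. Qed.

Lemma unit_min_le (R : realType) (n : nat) (f : 'I_n -> R) i :
  unit_min f <= f i.
Proof. exact: bigmin_le. Qed.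

Lemma unit_max_le1 (R : realType) (n : nat) (f : 'I_n -> R) :
  (forall i, f i <= 1) -> unit_max f <= 1.
Proof. by move=> f_le1; apply: bigmax_le. Qed.

Lemma unit_max_ge (R : realType) (n : nat) (f : 'I_n -> R) i :
  f i <= unit_max f.
Proof. exact: le_bigmax. Qed.

Theorem theoremV6 (R : realType) (n : nat) (hn : (2 <= n)%N)
    (T : R -> R -> R) (hT : is_strict_tnorm T)
    (tau : R -> \bar R) (htau : is_additive_generator T tau)
    (p q : R) (hp : 0 < p) (hq : 0 < q)
    (alpha : 'I_n -> triple R) (halpha : forall i, is_pfn (alpha i))
    (omega : 'I_n -> R) (homega : forall i, 0 < omega i <= 1)
    (homega_sum : \sum_(i < n) omega i = 1) :
  let mu_min := unit_min (fun i => mu (alpha i)) in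
  let mu_max := unit_max (fun i => mu (alpha i)) in
  let eta_min := unit_min (fun i => eta (alpha i)) in
  let nu_min := unit_min (fun i => nu (alpha i)) in
  let nu_max := unit_max (fun i => nu (alpha i)) in
  leW (Triple mu_min eta_min nu_max) (pfinwbm T tau p q omega alpha) /\
  leW (pfinwbm T tau p q omega alpha)
      (Triple mu_max (1 - (mu_max + nu_min)) nu_min).
Proof.
have tT := strict_tnorm_tnorm hT.
have omega_gt0 i : 0 < omega i by have /andP[] := homega i.
(* This makes the denominators [1 - omega i] positive, and with them the weights of the pairs. *)
have omega_lt1 := weight_lt1 hn omega_gt0 homega_sum.
pose w (ij : 'I_n * 'I_n) := omega ij.1 * omega ij.2 / (1 - omega ij.1).
have w_gt0 ij : ij.1 != ij.2 -> 0 < w ij.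
  by move=> _; rewrite divr_gt0 ?mulr_gt0 ?subr_gt0.
have w_sum : \sum_(ij : 'I_n * 'I_n | ij.1 != ij.2) w ij = 1.
  exact: bonf_weight_sum.
move=> mu_min mu_max eta_min nu_min nu_max; split.
  apply: (bonf_mean_lower htau tT hp hq w_gt0 w_sum) => //.
  - by apply: unit_min_ge0 => i; case: (halpha i) => /andP[].
  - by apply: unit_min_ge0 => i; case: (halpha i) => _ /andP[].
  - by apply: unit_max_le1 => i; case: (halpha i) => _ _ /andP[].
  - by move=> i; apply: (unit_min_le (fun i => mu (alpha i))).
  - by move=> i; apply: (unit_min_le (fun i => eta (alpha i))).
  - by move=> i; apply: (unit_max_ge (fun i => nu (alpha i))).
apply: (bonf_mean_upper htau tT hp hq w_gt0 w_sum) => //.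
- by apply: unit_min_ge0 => i; case: (halpha i) => _ _ /andP[].
- by apply: unit_max_le1 => i; case: (halpha i) => /andP[].
- by move=> i; apply: (unit_max_ge (fun i => mu (alpha i))).
- by move=> i; apply: (unit_min_le (fun i => nu (alpha i))).
Qed.
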